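(* Let $A\in\mathbb{R}^{n\times d}$ with $\mathrm{rank}(A)\ge k\ge 1$ and $\sigma_k>\sigma_{k+1}$, where $\sigma_i=\sigma_i(A)$, and let $b=f+\xi$ be as in the fixed design model. Let $\nu\in(0,1)$. Suppose that $R\in\mathbb{R}^{d\times k}$ has orthonormal columns and that $d_2(R,V_{A,k})\le\nu(1+\nu^2)^{-1/2}<1$. Then $$\mathcal{E}(x_R)\le\frac{(1+\nu)\,\|x^\star\|_2^2\,\sigma_{k+1}^2}{n}+\frac{\sigma^2k}{n}.$$
   Context: $\|\cdot\|_2$ is the Euclidean/spectral norm. $\sigma_1(A)\ge\sigma_2(A)\ge\cdots$ are the singular values of $A$ (with $\sigma_{k+1}=0$ if $k=\min(n,d)$), $V_{A,k}\in\mathbb{R}^{d\times k}$ is the matrix of the top $k$ right singular vectors in a thin SVD of $A$. $d_2(U,W)=\|P_U-P_W\|_2$, with $P_X$ the orthogonal projection onto the column space of $X$. $X^{+}$ is the Moore–Penrose pseudo-inverse, and $x_R=R(AR)^{+}b$. Fixed design model: $A$ and $f\in\mathbb{R}^n$ are fixed, and $b=f+\xi$ where the entries of $\xi$ are independent with mean $0$ and variance $\sigma^2$. $x^\star$ is the minimum-norm minimizer of $\mathbb{E}[\|Ax-b\|_2^2/n]$ over $x\in\mathbb{R}^d$ (so $Ax^\star=P_Af$). The excess risk of an estimator $\theta=\theta(A,b)$ is $\mathcal{E}(\theta)=\mathbb{E}[\|A\theta-Ax^\star\|_2^2/n]$, expectation over $\xi$. (The noise variance $\sigma^2$ is not to be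 confused with the singular values $\sigma_i$.) *)

(* Defs.v *)
From HB Require Import structures.
From mathcomp Require Import all_boot all_order all_algebra.
From mathcomp Require Import all_classical all_reals all_analysis.

Set Implicit Arguments.
Unset Strict Implicit.
Unset Printing Implicit Defensive.

Import Order.TTheory GRing.Theory Num.Theory.
Local Open Scope classical_set_scope.
Local Open Scope ring_scope.

Section LinearAlgebra.
Context {K : realType}.

(* The norm that the library puts on matrices is the max-norm, hence the
   explicit definitions of the Euclidean and spectral norms. *)
Definition norm2 {m} (x : 'cV[K]_m) : K := Num.sqrt (\sum_i x i 0 ^+ 2).

Definition spectral_norm {m n} (M : 'M[K]_(m, n)) : K :=
  sup [set norm2 (M *m x) | x in [set x : 'cV[K]_n | norm2 x <= 1]].

Definition orthonormal_cols {m n} (M : 'M[K]_(m, n)) : Prop :=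
  M^T *m M = 1%:M.

(* Row spaces are the library's primitive, so the column spaces of P and X
   are compared through their transposes. *)
Definition is_orthoproj {m n} (X : 'M[K]_(m, n)) (P : 'M[K]_m) : Prop :=
  [/\ P *m P = P, P^T = P & (P^T == X^T)%MS].

(* Total choice of the unique such matrix, see [orthoprojP] and
   [is_orthoproj_unique]. *)
Definition orthoproj {m n} (X : 'M[K]_(m, n)) : 'M[K]_m :=
  xget 0 [set P | is_orthoproj X P].

Definition subspace_dist {m n p} (U : 'M[K]_(m, n)) (W : 'M[K]_(m, p)) : K :=
  spectral_norm (orthoproj U - orthoproj W).

(* The four Penrose conditions. *)
Definition is_mpinv {m n} (X : 'M[K]_(m, n)) (Y : 'M[K]_(n, m)) : Prop :=
  [/\ X *m Y *m X = X, Y *m X *m Y = Y,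
      (X *m Y)^T = X *m Y & (Y *m X)^T = Y *m X].

(* Total choice of the unique such matrix, see [mpinvP] and
   [is_mpinv_unique]. *)
Definition mpinv {m n} (X : 'M[K]_(m, n)) : 'M[K]_(n, m) :=
  xget 0 [set Y | is_mpinv X Y].

Definition is_thin_svd {n d} (A : 'M[K]_(n, d)) (U : 'M[K]_(n, minn n d))
    (s : 'rV[K]_(minn n d)) (V : 'M[K]_(d, minn n d)) : Prop :=
  [/\ A = U *m diag_mx s *m V^T, orthonormal_cols U, orthonormal_cols V,
      (forall i, 0 <= s 0 i) &
      (forall i j : 'I_(minn n d), (i <= j)%N -> s 0 j <= s 0 i)].

(* [sing s i] is sigma_i: the index is 1-based (only i >= 1 is meaningful),
   and the value is 0 beyond the length of s. *)
Definition sing {p} (s : 'rV[K]_p) (i : nat) : K :=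
  if insub i.-1 is Some j then s 0 j else 0.

Definition first_cols {d p k} (le_kp : (k <= p)%N) (V : 'M[K]_(d, p)) :
  'M[K]_(d, k) := colsub (widen_ord le_kp) V.

Lemma rank_le_minn {n d k} {A : 'M[K]_(n, d)} :
  (k <= \rank A)%N -> (k <= minn n d)%N.
Proof.
by move=> le_kA; rewrite leq_min !(leq_trans le_kA) ?rank_leq_row ?rank_leq_col.
Qed.

Lemma row_gram_eq0 {m} (u : 'rV[K]_m) : u *m u^T = 0 -> u = 0.
Proof.
move=> /(congr1 (fun M : 'M[K]_1 => M ord0 ord0)); rewrite !mxE => /eqP.
rewrite psumr_eq0 => [/allP u0|i _]; last by rewrite mxE -expr2 sqr_ge0.
apply/rowP => i; rewrite mxE.
by have := u0 i (mem_index_enum i); rewrite mxE -expr2 sqrf_eq0 => /eqP.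
Qed.

Lemma gram_unit {m r} (C : 'M[K]_(r, m)) : row_free C -> C *m C^T \in unitmx.
Proof.
move=> freeC; rewrite -row_free_unit -kermx_eq0; apply/eqP/row_matrixP => i.
rewrite row0; set u := row i _.
have u0 : u *m (C *m C^T) = 0.
  by apply/sub_kermxP; rewrite row_sub.
have /row_gram_eq0 uC0 : (u *m C) *m (u *m C)^T = 0.
  by rewrite trmx_mul !mulmxA -(mulmxA u) u0 mul0mx.
by apply: (row_free_inj freeC); rewrite uC0 mul0mx.
Qed.

Lemma is_mpinv_exists {m n} (X : 'M[K]_(m, n)) : exists Y, is_mpinv X Y.
Proof.
have [r [B [C [XE uB uC]]]] : exists r (B : 'M[K]_(r, n)) (C : 'M[K]_(m, r)),
    [/\ X = C *m B, B *m B^T \in unitmx & C^T *m C \in unitmx].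
  exists (\rank X), (row_base X), (col_base X); split.
  - by rewrite mulmx_base.
  - by rewrite gram_unit ?row_base_free.
  - have := @gram_unit _ _ (col_base X)^T; rewrite trmxK; apply.
    by rewrite /row_free mxrank_tr; exact: col_base_full.
have symB : (invmx (B *m B^T))^T = invmx (B *m B^T).
  by rewrite trmx_inv trmx_mul trmxK.
have symC : (invmx (C^T *m C))^T = invmx (C^T *m C).
  by rewrite trmx_inv trmx_mul trmxK.
pose Y := B^T *m invmx (B *m B^T) *m (invmx (C^T *m C) *m C^T).
have XY : X *m Y = C *m invmx (C^T *m C) *m C^T.
  rewrite XE /Y !mulmxA -(mulmxA C B) -(mulmxA C (B *m _)).
  by rewrite mulmxV // mulmx1.
have YX : Y *m X = B^T *m invmx (B *m B^T) *m B.
  rewrite XE /Y !mulmxA -(mulmxA _ C^T C) -(mulmxA _ (invmx _) (C^T *m C)).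
  by rewrite mulVmx // mulmx1.
exists Y; split.
- rewrite XY XE !mulmxA -(mulmxA _ C^T C) -(mulmxA _ (invmx _) (C^T *m C)).
  by rewrite mulVmx // mulmx1.
- rewrite YX /Y !mulmxA -(mulmxA _ B B^T) -(mulmxA _ (invmx _) (B *m B^T)).
  by rewrite mulVmx // mulmx1.
- by rewrite XY !trmx_mul trmxK symC mulmxA.
- by rewrite YX !trmx_mul trmxK symB mulmxA.
Qed.

Lemma mpinvP {m n} (X : 'M[K]_(m, n)) : is_mpinv X (mpinv X).
Proof. exact: xgetPex (is_mpinv_exists X). Qed.

Lemma is_mpinv_unique {m n} (X : 'M[K]_(m, n)) Y Z :
  is_mpinv X Y -> is_mpinv X Z -> Y = Z.
Proof.
move=> [XYX YXY sXY sYX] [XZX ZXZ sXZ sZX].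
have XYZ : X *m Y = X *m Z.
  by rewrite -{1}XZX -(mulmxA _ X Y) -sXZ -sXY -trmx_mul mulmxA XYX.
have YZX : Y *m X = Z *m X.
  have E : Y *m X = (Y *m X) *m (Z *m X) by rewrite -mulmxA (mulmxA X) XZX.
  by rewrite E -sYX -sZX -trmx_mul -mulmxA (mulmxA X) XYX.
by rewrite -YXY -mulmxA XYZ mulmxA YZX ZXZ.
Qed.

Lemma is_orthoproj_mpinv {m n} (X : 'M[K]_(m, n)) :
  is_orthoproj X (X *m mpinv X).
Proof.
have [XYX YXY sXY sYX] := mpinvP X; split => //.
  by rewrite mulmxA XYX.
apply/andP; split; first by rewrite trmx_mul submxMl.
by rewrite -{1}XYX trmx_mul submxMl.
Qed.

Lemma orthoprojP {m n} (X : 'M[K]_(m, n)) : is_orthoproj X (orthoproj X).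
Proof. by apply: xgetPex; exists (X *m mpinv X); exact: is_orthoproj_mpinv. Qed.

Lemma is_orthoproj_unique {m n} (X : 'M[K]_(m, n)) P Q :
  is_orthoproj X P -> is_orthoproj X Q -> P = Q.
Proof.
move=> [PP sP /andP[PX XP]] [QQ sQ /andP[QX XQ]].
have PQ : P *m Q = P.
  have /submxP[D] := submx_trans PX XQ; rewrite sP sQ => ->.
  by rewrite -mulmxA QQ.
have QP : Q *m P = Q.
  have /submxP[D] := submx_trans QX XP; rewrite sP sQ => ->.
  by rewrite -mulmxA PP.
by rewrite -[LHS]sP -{1}PQ trmx_mul sP sQ QP.
Qed.

Definition x_sketch {n d k} (R : 'M[K]_(d, k)) (A : 'M[K]_(n, d))
  (b : 'cV[K]_n) : 'cV[K]_d := R *m mpinv (A *m R) *m b.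

End LinearAlgebra.

Section FixedDesign.
Context {disp : measure_display} {W : measurableType disp} {K : realType}.
Variable P : probability W K.

Definition mutually_independent {I : finType} (X : I -> {RV P >-> K}) : Prop :=
  forall (J : {set I}) (B : I -> set K),
    (forall i, i \in J -> measurable (B i)) ->
    P (\bigcap_(i in [set` J]) (X i @^-1` B i)) =
    (\prod_(i in J) P (X i @^-1` B i))%E.

(* Zero expectation and real-valued variance force every [xi i] to be square
   integrable, so no integrability hypothesis is needed. *)
Definition white_noise {n} (xi : 'I_n -> {RV P >-> K}) (sigma : K) : Prop :=
  [/\ mutually_independent xi,
      (forall i, 'E_P[xi i] = 0)%E &
      (forall i, 'V_P[xi i] = (sigma ^+ 2)%:E)%E].

Definition response {n} (f : 'cV[K]_n) (xi : 'I_n -> {RV P >-> K}) (w : W) :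
  'cV[K]_n := f + \col_i xi i w.

Definition risk {n d} (A : 'M[K]_(n, d)) (b : W -> 'cV[K]_n) (x : 'cV[K]_d) :
  \bar K := 'E_P[fun w => (norm2 (A *m x - b w) ^+ 2 / n%:R)%R]%E.

Definition is_min_norm_minimizer {d} (F : 'cV[K]_d -> \bar K)
    (x : 'cV[K]_d) : Prop :=
  (forall y, F x <= F y)%E /\
  (forall y, (forall z, F y <= F z)%E -> norm2 x <= norm2 y).

Definition excess_risk {n d} (A : 'M[K]_(n, d)) (b : W -> 'cV[K]_n)
    (xstar : 'cV[K]_d) (theta : 'M[K]_(n, d) -> 'cV[K]_n -> 'cV[K]_d) :
  \bar K :=
  'E_P[fun w => (norm2 (A *m theta A (b w) - A *m xstar) ^+ 2 / n%:R)%R]%E.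

End FixedDesign.

(* Main.v *)
Require Import Defs.
From HB Require Import structures.
From mathcomp Require Import all_boot all_order all_algebra.
From mathcomp Require Import ring lra.
From mathcomp Require Import all_classical all_reals all_analysis.
From mathcomp Require Import measurable_realfun.
Import Order.TTheory GRing.Theory Num.Theory.
Local Open Scope classical_set_scope.
Local Open Scope ring_scope.

(** Write Q = A R (A R)^+ for the orthogonal projection onto the range of A R.
The estimator has fitted value A x_R = Q b = Q f + Q xi, so the excess risk is a
bias plus a variance; the common factor 1 / n is left out below.

Variance. The noise is uncorrelated with variance sigma^2, so the mean of
|c + M xi|^2 is |c|^2 + sigma^2 |M|_F^2 ([has_mean_sqnorm]). For M = Q the
squared Frobenius norm is the trace of Q ([frobenius_proj]), which is at most k
because (A R)^+ (A R), a projection in dimension k, has the same trace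
([trace_mpinv_le]). Mutual independence gives uncorrelatedness through
E[XY] = E[X] E[Y] ([expectation_mul_indep]): the law of (X, Y) is the product
of the two laws, and Fubini applies.

Bias. The same formula with M = -1 shows that xstar minimises |A y - f|^2, so
that A xstar = A A^+ f ([least_squares_fit]). As the range of Q lies in that of
A, Q f = Q A xstar, and the bias is the squared distance from A xstar to the
range of A R. It is at most |A (xstar - R y)|^2 for every y. Let W hold the top
k right singular vectors. The assumption on subspace_dist says that the sine of
the largest angle between the ranges of R and W is at most that of arctan nu,
whence |u - W W^T u| <= nu |W W^T u| for u in the range of R ([sin_to_tan]).
In particular W^T R is invertible ([cross_gram_unit]), and y can be chosen with
W^T R y = W^T xstar. Then z = xstar - R y is orthogonal to W, so
|A z| <= sigma_{k+1} |z| ([svd_tail_le]), while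
|z|^2 <= (1 + nu^2) |xstar|^2 by the tangent bound ([sketch_bias_le]).
Finally nu^2 <= nu because 0 < nu < 1. *)

Section LinearAlgebra.
Set Implicit Arguments.
Unset Strict Implicit.
Context {K : realType}.

(** * Euclidean and spectral norms *)

Lemma norm2_sqr {m} (x : 'cV[K]_m) : norm2 x ^+ 2 = \sum_i x i 0 ^+ 2.
Proof. by rewrite sqr_sqrtr// sumr_ge0// => i _; exact: sqr_ge0. Qed.

Lemma norm2_ge0 {m} (x : 'cV[K]_m) : 0 <= norm2 x.
Proof. exact: sqrtr_ge0. Qed.

Lemma norm2_gram {m} (x : 'cV[K]_m) : norm2 x ^+ 2 = (x^T *m x) 0 0.
Proof.
rewrite norm2_sqr mxE; apply: eq_bigr => i _.
by rewrite !mxE expr2.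
Qed.

Lemma norm20 {m} : norm2 (0 : 'cV[K]_m) = 0.
Proof.
by rewrite /norm2 big1 ?sqrtr0// => i _; rewrite mxE expr0n.
Qed.

Lemma norm2_eq0 {m} (x : 'cV[K]_m) : norm2 x ^+ 2 <= 0 -> x = 0.
Proof.
move=> x_le0; apply: trmx_inj; rewrite trmx0; apply: row_gram_eq0.
apply/matrixP => i j; rewrite !ord1 trmxK -norm2_gram mxE.
by apply/eqP; rewrite eq_le x_le0 sqr_ge0.
Qed.

Lemma norm2Z {m} (a : K) (x : 'cV[K]_m) : 0 <= a -> norm2 (a *: x) = a * norm2 x.
Proof.
move=> a0; apply: (@pexpIrn _ 2) => //; rewrite ?nnegrE ?mulr_ge0 ?norm2_ge0//.
rewrite exprMn !norm2_sqr mulr_sumr; apply: eq_bigr => i _.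
by rewrite mxE exprMn.
Qed.

Lemma norm2N {m} (x : 'cV[K]_m) : norm2 (- x) = norm2 x.
Proof. by congr Num.sqrt; apply: eq_bigr => i _; rewrite mxE sqrrN. Qed.

(** The cross term is absorbed with weight t: the right-hand side exceeds the
left-hand side by the sum of the squares of t a_i + b_i / t. *)
Lemma norm2B_young {m} (a b : 'cV[K]_m) (t : K) : 0 < t ->
  norm2 (a - b) ^+ 2 <= (1 + t ^+ 2) * (norm2 a ^+ 2 + norm2 b ^+ 2 / t ^+ 2).
Proof.
move=> t0; rewrite !norm2_sqr mulr_suml -big_split/= mulr_sumr.
apply: ler_sum => i _; rewrite !mxE -subr_ge0.
rewrite (_ : _ - _ = (t * a i 0 + b i 0 / t) ^+ 2) ?sqr_ge0//.
by field; rewrite gt_eqF.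
Qed.

Lemma norm2_isometry {m n} (Q : 'M[K]_(m, n)) (x : 'cV[K]_n) :
  orthonormal_cols Q -> norm2 (Q *m x) ^+ 2 = norm2 x ^+ 2.
Proof.
by move=> QQ; rewrite !norm2_gram trmx_mul mulmxA -(mulmxA x^T) QQ mulmx1.
Qed.

Lemma norm2_pythagoras {m} (P : 'M[K]_m) (x : 'cV[K]_m) :
  P *m P = P -> P^T = P ->
  norm2 x ^+ 2 = norm2 (P *m x) ^+ 2 + norm2 (x - P *m x) ^+ 2.
Proof.
move=> PP sP.
have E : (x - P *m x)^T *m (x - P *m x) = x^T *m x - (P *m x)^T *m (P *m x).
  rewrite [(x - _)^T]linearB/= trmx_mul sP.
  rewrite mulmxBr !mulmxBl !mulmxA -(mulmxA x^T P P) PP.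
  by rewrite subrr subr0.
have /matrixP/(_ 0 0) := E; rewrite [RHS]mxE [X in _ = _ + X]mxE -!norm2_gram => ->.
by rewrite addrC subrK.
Qed.

(** Since [spectral_norm] is a supremum, this rests on the boundedness of the
image of the unit ball; the row sums of |M| provide a crude bound. *)
Lemma norm2_mul_le_spectral {m n} (M : 'M[K]_(m, n)) (x : 'cV[K]_n) :
  norm2 (M *m x) <= spectral_norm M * norm2 x.
Proof.
have [x0|x_gt0] := leP (norm2 x) 0.
  have -> : x = 0.
    apply: norm2_eq0; have -> : norm2 x = 0 by apply/le_anti; rewrite x0 norm2_ge0.
    by rewrite expr0n.
  by rewrite mulmx0 !norm20 mulr0.
(* By homogeneity it suffices to bound M on the unit vector x / |x|. *)
have E : x = norm2 x *: ((norm2 x)^-1 *: x) by rewrite scalerA mulfV ?scale1r ?gt_eqF.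
rewrite [in leLHS]E -scalemxAr norm2Z ?norm2_ge0// mulrC ler_wpM2r ?norm2_ge0//.
apply: ub_le_sup; last first.
  exists ((norm2 x)^-1 *: x) => //=.
  by rewrite norm2Z ?invr_ge0 ?norm2_ge0// mulVf ?gt_eqF.
exists (Num.sqrt (\sum_i (\sum_j `|M i j|) ^+ 2)) => _ [y /= y1 <-].
apply: ler_wsqrtr; apply: ler_sum => i _.
rewrite -real_normK ?num_real// ler_sqr ?nnegrE ?sumr_ge0//.
rewrite mxE; apply: le_trans (ler_norm_sum _ _ _) _; apply: ler_sum => j _.
rewrite normrM ler_piMr// -ler_sqr ?nnegrE// expr1n real_normK ?num_real//.
apply: (@le_trans _ _ (norm2 y ^+ 2)); last first.
  by rewrite exprn_ile1 ?norm2_ge0.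
rewrite norm2_sqr (bigD1 j)//= lerDl sumr_ge0// => l _; exact: sqr_ge0.
Qed.

(** * Orthogonal projections and least squares *)

Lemma orthoproj_orthonormal {m n} (Q : 'M[K]_(m, n)) :
  orthonormal_cols Q -> orthoproj Q = Q *m Q^T.
Proof.
move=> QQ; apply: is_orthoproj_unique (orthoprojP Q) _; split.
- by rewrite mulmxA -(mulmxA Q) QQ mulmx1.
- by rewrite trmx_mul trmxK.
- rewrite trmx_mul trmxK submxMl/=; apply/submxP; exists Q^T.
  by rewrite mulmxA QQ mul1mx.
Qed.

Lemma orthonormal_proj {m n} (Q : 'M[K]_(m, n)) : orthonormal_cols Q ->
  (Q *m Q^T) *m (Q *m Q^T) = Q *m Q^T /\ (Q *m Q^T)^T = Q *m Q^T.
Proof.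
move=> QQ; split; last by rewrite trmx_mul trmxK.
by rewrite mulmxA -(mulmxA Q) QQ mulmx1.
Qed.

(** The trace of 1 - P = (1 - P)^T (1 - P) is a sum of squares. *)
Lemma trace_proj_le {k} (P : 'M[K]_k) : P *m P = P -> P^T = P -> \tr P <= k%:R.
Proof.
move=> PP sP; rewrite -(mxtrace1 K) -subr_ge0 -linearB/=.
have -> : 1%:M - P = (1%:M - P)^T *m (1%:M - P).
  rewrite [(1%:M - P)^T]linearB/= trmx1 sP mulmxBl mul1mx mulmxBr mulmx1 PP subrr.
  by rewrite subr0.
apply: sumr_ge0 => i _; rewrite mxE; apply: sumr_ge0 => j _.
by rewrite mxE -expr2 sqr_ge0.
Qed.

Lemma frobenius_proj {n} (P : 'M[K]_n) : P *m P = P -> P^T = P ->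
  \sum_i \sum_j P i j ^+ 2 = \tr P.
Proof.
move=> PP sP; apply: eq_bigr => i _; rewrite -[in RHS]PP mxE.
by apply: eq_bigr => j _; rewrite -[in X in _ = _ * X]sP mxE expr2.
Qed.

Lemma mpinv_proj {m n} (X : 'M[K]_(m, n)) :
  [/\ X *m mpinv X *m (X *m mpinv X) = X *m mpinv X,
      (X *m mpinv X)^T = X *m mpinv X & X *m mpinv X *m X = X].
Proof. by have [XYX _ sXY _] := mpinvP X; split; rewrite ?mulmxA ?XYX. Qed.

(** The trace is that of X^+ X, which is a projection of the small dimension
k. *)
Lemma trace_mpinv_le {m k} (X : 'M[K]_(m, k)) :
  \tr (X *m mpinv X) <= k%:R.
Proof.
have [_ YXY _ sYX] := mpinvP X.
by rewrite mxtrace_mulC trace_proj_le// mulmxA YXY.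
Qed.

(** By Pythagoras the squared residual of y is |A y - A A^+ f|^2 plus the
squared distance from f to the range of A, and y = A^+ f makes the first term
vanish. *)
Lemma least_squares_fit {n d} (A : 'M[K]_(n, d)) (f : 'cV[K]_n) (x : 'cV[K]_d) :
  (forall y, norm2 (A *m x - f) ^+ 2 <= norm2 (A *m y - f) ^+ 2) ->
  A *m x = A *m mpinv A *m f.
Proof.
move=> /(_ (mpinv A *m f)); have [idP symP PA] := mpinv_proj A.
rewrite mulmxA [leLHS](norm2_pythagoras _ idP symP); set Q := A *m mpinv A.
have -> : Q *m (A *m x - f) = A *m x - Q *m f by rewrite mulmxBr mulmxA PA.
have -> : A *m x - f - (A *m x - Q *m f) = Q *m f - f.
  by rewrite opprB addrC addrA subrK.
rewrite gerDr => /norm2_eq0 /eqP; rewrite subr_eq0 => /eqP.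
exact.
Qed.

(** * The angle between the sketch and the top singular subspace *)

(** The distance between the projections bounds the sine of the angle from a
vector u = R y to the range of W; dividing by the cosine, which Pythagoras
provides, turns the sine nu (1 + nu^2)^(-1/2) into the tangent nu. *)
Lemma sin_to_tan {d p q} (R : 'M[K]_(d, p)) (W : 'M[K]_(d, q)) (nu : K)
    (y : 'cV[K]_p) :
  0 <= nu -> orthonormal_cols R -> orthonormal_cols W ->
  subspace_dist R W <= nu / Num.sqrt (1 + nu ^+ 2) ->
  norm2 (R *m y - W *m W^T *m (R *m y)) ^+ 2
    <= nu ^+ 2 * norm2 (W *m W^T *m (R *m y)) ^+ 2.
Proof.
move=> nu0 oR oW hdist; set u := R *m y.
have [idW symW] := orthonormal_proj oW.
have Pu : R *m R^T *m u = u by rewrite /u mulmxA -(mulmxA R) oR mulmx1.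
have : norm2 (u - W *m W^T *m u) <= nu / Num.sqrt (1 + nu ^+ 2) * norm2 u.
  rewrite -{1}Pu -mulmxBl -!orthoproj_orthonormal//.
  apply: le_trans (norm2_mul_le_spectral _ _) _.
  by rewrite ler_wpM2r ?norm2_ge0.
have q0 : 0 < 1 + nu ^+ 2 by rewrite ltr_pwDl// sqr_ge0.
rewrite -ler_sqr ?nnegrE ?norm2_ge0//; last first.
  by rewrite mulr_ge0 ?norm2_ge0// divr_ge0 ?sqrtr_ge0.
rewrite !exprMn exprVn (sqr_sqrtr (ltW q0)) mulrAC ler_pdivlMr//.
rewrite [in X in _ <= X](norm2_pythagoras _ idW symW).
set a := _ ^+ 2; set b := norm2 _ ^+ 2 => H; nra.
Qed.

(** A vector orthogonal to the first k right singular vectors has nonzero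
coordinates only along singular values that are at most sigma_{k+1}. *)
Lemma svd_tail_le {n d k} (A : 'M[K]_(n, d)) U s V (le_kp : (k <= minn n d)%N)
    (z : 'cV[K]_d) :
  is_thin_svd A U s V -> (first_cols le_kp V)^T *m z = 0 ->
  norm2 (A *m z) ^+ 2 <= sing s k.+1 ^+ 2 * norm2 z ^+ 2.
Proof.
move=> [AE oU oV s0 s_dec] Vz0.
have idV := (orthonormal_proj oV).1; have symV := (orthonormal_proj oV).2.
have Vz : norm2 (V^T *m z) ^+ 2 <= norm2 z ^+ 2.
  rewrite -(norm2_isometry _ oV) mulmxA [leRHS](norm2_pythagoras _ idV symV).
  by rewrite lerDl sqr_ge0.
rewrite AE -!mulmxA norm2_isometry//.
apply: (@le_trans _ _ (sing s k.+1 ^+ 2 * norm2 (V^T *m z) ^+ 2)); last first.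
  by rewrite ler_wpM2l// sqr_ge0.
rewrite !norm2_sqr mulr_sumr; apply: ler_sum => i _.
rewrite mul_diag_mx mxE exprMn.
have [ik|ki] := ltnP i k.
  suff -> : (V^T *m z) i 0 = 0 by rewrite expr0n !mulr0.
  have /matrixP/(_ (Ordinal ik) 0) := Vz0; rewrite !mxE => E; rewrite -[RHS]E.
  apply: eq_bigr => j _; rewrite !mxE; congr (V _ _ * _).
  exact: val_inj.
rewrite ler_wpM2r ?sqr_ge0// ler_sqr ?nnegrE//.
  (* As k <= i, the index k is in range and the default value 0 of sing does
     not occur. *)
  rewrite /sing /=; case: insubP => [j _ jk|]; last first.
    by rewrite (leq_ltn_trans ki).
  by apply: s_dec; rewrite jk.
by rewrite /sing; case: insubP.
Qed.

(** A vector of the range of R that W^T kills has a zero cosine, hence by the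
tangent bound a zero sine as well: it is 0. *)
Lemma cross_gram_unit {d k} (R W : 'M[K]_(d, k)) (nu : K) :
  0 <= nu -> orthonormal_cols R -> orthonormal_cols W ->
  subspace_dist R W <= nu / Num.sqrt (1 + nu ^+ 2) -> W^T *m R \in unitmx.
Proof.
move=> nu0 oR oW hdist.
rewrite -unitmx_tr -row_free_unit -kermx_eq0; apply/eqP/row_matrixP => i.
rewrite row0; set u := row i _.
have u0 : u *m (W^T *m R)^T = 0 by apply/sub_kermxP; rewrite row_sub.
have Wu0 : W *m W^T *m (R *m u^T) = 0.
  rewrite -mulmxA (_ : W^T *m _ = 0) ?mulmx0// mulmxA -[LHS]trmxK trmx_mul trmxK.
  by rewrite u0 trmx0.
have := sin_to_tan u^T nu0 oR oW hdist.
rewrite Wu0 norm20 expr0n mulr0 subr0 => /norm2_eq0 Ru0.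
by apply: trmx_inj; rewrite trmx0 -[u^T]mul1mx -oR -mulmxA Ru0 mulmx0.
Qed.

(** The competitor R y with W^T R y = W^T x matches x on the top singular
subspace, so that the error x - R y lives where A contracts by sigma_{k+1}. *)
Lemma sketch_bias_le {n d k} (A : 'M[K]_(n, d)) U s V
    (le_kp : (k <= minn n d)%N) (R : 'M[K]_(d, k)) (nu : K) (x : 'cV[K]_d) :
  0 < nu -> is_thin_svd A U s V -> orthonormal_cols R ->
  subspace_dist R (first_cols le_kp V) <= nu / Num.sqrt (1 + nu ^+ 2) ->
  norm2 (A *m R *m mpinv (A *m R) *m (A *m x) - A *m x) ^+ 2
    <= (1 + nu ^+ 2) * norm2 x ^+ 2 * sing s k.+1 ^+ 2.
Proof.
move=> nu0 hsvd oR hdist; set Q := A *m R *m _; set W := first_cols le_kp V.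
have oW : orthonormal_cols W.
  have [_ _ oV _ _] := hsvd.
  apply/matrixP => i j; have /matrixP/(_ (widen_ord le_kp i) (widen_ord le_kp j)) := oV.
  rewrite !mxE => E; rewrite -[RHS]E; apply: eq_bigr => l _; by rewrite !mxE.
have Wunit := cross_gram_unit (ltW nu0) oR oW hdist.
pose y := invmx (W^T *m R) *m (W^T *m x).
have Wy : W^T *m (R *m y) = W^T *m x by rewrite mulmxA mulmxA mulmxV// mul1mx.
pose z := x - R *m y.
have Wz : W^T *m z = 0 by rewrite mulmxBr Wy subrr.
have [idQ symQ QAR] := mpinv_proj (A *m R).
(* A z differs from A x by a vector of the range of Q, and 1 - Q is a
   contraction. *)
have Qz : norm2 (Q *m (A *m x) - A *m x) ^+ 2 <= norm2 (A *m z) ^+ 2.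
  have -> : Q *m (A *m x) - A *m x = - (A *m z - Q *m (A *m z)).
    have -> : Q *m (A *m z) = Q *m (A *m x) - A *m (R *m y).
      by rewrite mulmxBr mulmxBr [A *m (R *m y)]mulmxA [Q *m (_ *m y)]mulmxA QAR.
    by rewrite mulmxBr !opprB addrA subrK.
  by rewrite norm2N [leRHS](norm2_pythagoras _ idQ symQ) lerDr sqr_ge0.
apply: le_trans Qz _; apply: le_trans (svd_tail_le hsvd Wz) _.
rewrite mulrC ler_wpM2r ?sqr_ge0//.
have tanR := sin_to_tan y (ltW nu0) oR oW hdist.
have [idW symW] := orthonormal_proj oW.
rewrite [in X in _ <= X](norm2_pythagoras x idW symW).
move: tanR; rewrite -(mulmxA W) Wy mulmxA => tanR.
have -> : z = (x - W *m W^T *m x) - (R *m y - W *m W^T *m x).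
  by rewrite opprB addrA subrK.
apply: le_trans (norm2B_young _ _ nu0) _; rewrite ler_wpM2l ?addr_ge0 ?sqr_ge0//.
by rewrite addrC lerD2r ler_pdivrMr ?exprn_gt0// mulrC.
Qed.

End LinearAlgebra.

(** * Second moments of white noise *)

Section Moments.
Set Implicit Arguments.
Unset Strict Implicit.
Context {disp : measure_display} {W : measurableType disp} {K : realType}.
Variable P : probability W K.

Section Pair.
Variables X Y : {RV P >-> K}.
Let XY (w : W) : K * K := (X w, Y w).
Let mXY : measurable_fun setT XY.
Proof. by apply: measurable_fun_pair. Qed.
HB.instance Definition _ := isMeasurableFun.Build _ _ _ _ XY mXY.

(** A measure on the plane is determined by its values on rectangles, so the
law of (X, Y) is the product measure, against which the integral of x y
splits. *)
Lemma expectation_mul_indep :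
  (forall B C, measurable B -> measurable C ->
     P (X @^-1` B `&` Y @^-1` C) = (P (X @^-1` B) * P (Y @^-1` C))%E) ->
  (X : W -> K) \in Lfun P 1 -> (Y : W -> K) \in Lfun P 1 ->
  X \* Y \in Lfun P 1 ->
  ('E_P[X \* Y] = 'E_P[X] * 'E_P[Y])%E.
Proof.
move=> XYind X1 Y1 XY1.
pose pr (z : K * K) : \bar K := (z.1 * z.2)%:E.
have mprod : measurable_fun setT pr.
  apply/measurable_EFinP; exact: measurable_funM.
have iprod : P.-integrable setT (pr \o XY).
  exact/Lfun1_integrable.
have joint B : measurable B ->
    (distribution P X \x distribution P Y)%E B = distribution P XY B.
  by apply: product_measure_unique => C D mC mD; rewrite -XYind.
have ijoint : (distribution P X \x distribution P Y)%E.-integrable setT pr.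
  have := integrable_pushforward mXY mprod (D := setT) iprod measurableT.
  move=> /integrableP[_ fin]; apply/integrableP; split => //.
  rewrite (eq_measure_integral (distribution P XY))// => B mB _; exact: joint.
have law_mean (Z : {RV P >-> K}) : (Z : W -> K) \in Lfun P 1 ->
   (\int[distribution P Z]_x x%:E = 'E_P[Z])%E.
  move=> Z1; rewrite unlock integral_distribution//.
  exact/Lfun1_integrable.
have -> : ('E_P[X \* Y] = \int[P]_w (pr \o XY) w)%E by rewrite unlock.
transitivity (\int[distribution P XY]_z pr z)%E.
  by rewrite integral_distribution.
rewrite (eq_measure_integral (distribution P X \x distribution P Y)%E);
  last by move=> B mB _; apply/esym; exact: joint.
rewrite -integral12_prod_meas1//= /fubini_F/=.
transitivity (\int[distribution P X]_x (x%:E * 'E_P[Y]))%E.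
  apply: eq_integral => x _; rewrite -(law_mean Y)// -integralZl//.
  apply/integrable_pushforward => //=; exact/Lfun1_integrable.
rewrite -[in LHS](fineK (expectation_fin_num Y1)) integralZr//; last first.
  apply/integrable_pushforward => //=; exact/Lfun1_integrable.
by rewrite law_mean// fineK// expectation_fin_num.
Qed.
End Pair.

(** Integrability is bundled with the value of the mean, so that means can be
computed by following the structure of a random variable. *)
Definition has_mean (X : W -> K) (m : K) : Prop :=
  X \in Lfun P 1 /\ 'E_P[X]%E = m%:E.

Lemma has_mean_cst c : has_mean (cst c) c.
Proof. by split; [exact: Lfun_cst|exact: expectation_cst]. Qed.

Lemma has_meanD X Y a b :
  has_mean X a -> has_mean Y b -> has_mean (X \+ Y) (a + b).
Proof.
by move=> [X1 EX] [Y1 EY]; split; [exact: rpredD|rewrite expectationD// EX EY].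
Qed.

Lemma has_meanZ X a c : has_mean X a -> has_mean (fun w => c * X w) (c * a).
Proof.
move=> [X1 EX]; have -> : (fun w => c * X w) = c \o* X.
  by apply/funext => w /=; rewrite mulrC.
by split; [exact: Lfun_scale|rewrite expectationZl// EX].
Qed.

Lemma has_mean_sum {I : finType} (X : I -> W -> K) (m : I -> K) :
  (forall i, has_mean (X i) (m i)) ->
  has_mean (fun w => \sum_i X i w) (\sum_i m i).
Proof.
move=> Xm; have -> : (fun w => \sum_i X i w) = \sum_i X i.
  by apply/funext => w; rewrite fct_sumE.
apply: (big_ind2 has_mean) => //; first exact: has_mean_cst.
by move=> Y a Z b; exact: has_meanD.
Qed.

(** The centred variable is X itself, so the variance is the integral of
X^2. *)
Lemma Lfun2_of_variance (X : {RV P >-> K}) (v : K) :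
  'E_P[X]%E = 0%E -> 'V_P[X]%E = v%:E -> (X : W -> K) \in Lfun P 2%:E.
Proof.
move=> EX; rewrite /variance covariance.unlock EX/= expectation.unlock => VX.
rewrite inE; apply/andP; split; rewrite inE/=; first exact: measurable_funPT.
rewrite /finite_norm Lnorm.unlock; apply: poweR_lty.
rewrite (_ : (\int[P]_w _)%E = v%:E) ?ltry// -VX; apply: eq_integral => w _.
by rewrite !fctE/= subr0 -expr2 powR_mulrn// real_normK ?num_real.
Qed.

Lemma white_noise_moments {n} (xi : 'I_n -> {RV P >-> K}) sigma :
  white_noise xi sigma ->
  (forall i, has_mean (xi i) 0) /\
  (forall i j, has_mean (fun w => xi i w * xi j w)
                 (sigma ^+ 2 * (i == j)%:R)).
Proof.
move=> [ind E0 V0].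
have X2 i : (xi i : W -> K) \in Lfun P 2%:E by exact: Lfun2_of_variance.
have X1 i : (xi i : W -> K) \in Lfun P 1.
  by apply: Lfun_subset12 => //; exact: fin_num_measure.
split=> [i|i j]; first by split; [|exact: E0].
split; first exact: Lfun2_mul_Lfun1.
have [<-|ij] := eqVneq i j.
  rewrite mulr1 -(V0 i) varianceE// E0 expe2 mul0e sube0.
  by congr expectation; apply/funext => w; rewrite /= expr2.
rewrite mulr0 (expectation_mul_indep (X := xi i) (Y := xi j))//; last 1 first.
- exact: Lfun2_mul_Lfun1.
- by rewrite !E0 mul0e.
move=> B C mB mC.
have := ind [set i; j]%SET (fun l => if l == i then B else C).
rewrite big_setU1/= ?inE//= big_set1 eqxx eq_sym (negbTE ij) => <-.
  congr (P _); apply/seteqP; split => w /=.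
    move=> [Bw Cw] l /=; rewrite !inE => /orP[|] /eqP ->; rewrite ?eqxx//.
    by rewrite eq_sym (negbTE ij).
  move=> H; split.
    by have := H i; rewrite /= !inE eqxx; exact.
  by have := H j; rewrite /= !inE eqxx orbT eq_sym (negbTE ij); exact.
by move=> l _; case: ifP.
Qed.

Lemma has_mean_sqnorm {m n} (xi : 'I_n -> {RV P >-> K}) sigma
    (c : 'cV[K]_m) (M : 'M[K]_(m, n)) :
  white_noise xi sigma ->
  has_mean (fun w => norm2 (c + M *m \col_i xi i w) ^+ 2)
    (norm2 c ^+ 2 + sigma ^+ 2 * \sum_i \sum_j M i j ^+ 2).
Proof.
move=> /white_noise_moments[xi1 xi2].
rewrite norm2_sqr mulr_sumr -big_split/=.
under eq_fun do rewrite norm2_sqr.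
apply: has_mean_sum => i.
have -> : (fun w => (c + M *m \col_j xi j w) i 0 ^+ 2) =
  cst (c i 0 ^+ 2) \+ (fun w => (2 * c i 0) * \sum_j M i j * xi j w)
  \+ (fun w => \sum_j \sum_l M i j * M i l * (xi j w * xi l w)).
  apply/funext => w /=; rewrite !mxE.
  under [X in (_ + X) ^+ 2]eq_bigr do rewrite mxE.
  have -> : \sum_j \sum_l M i j * M i l * (xi j w * xi l w) =
      (\sum_j M i j * xi j w) ^+ 2.
    rewrite expr2 big_distrlr/=; apply: eq_bigr => j _; apply: eq_bigr => l _.
    by ring.
  by ring.
(* The target value is put in the shape of the expanded square, with 0 for
   each first moment and sigma^2 [j = l] for each second moment. *)
have -> : c i 0 ^+ 2 + sigma ^+ 2 * \sum_j M i j ^+ 2 =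
    c i 0 ^+ 2 + 2 * c i 0 * (\sum_(j < n) M i j * 0) +
    \sum_j \sum_l M i j * M i l * (sigma ^+ 2 * (j == l)%:R).
  rewrite [\sum_j M i j * 0]big1 ?mulr0 ?addr0 => [|j _]; last by rewrite mulr0.
  congr (_ + _); rewrite mulr_sumr; apply: eq_bigr => j _.
  rewrite (bigD1 j)//= big1 ?addr0 => [|l lj]; first by rewrite eqxx mulr1; ring.
  by rewrite eq_sym (negbTE lj) !mulr0.
apply: has_meanD; first apply: has_meanD.
- exact: has_mean_cst.
- by apply: has_meanZ; apply: has_mean_sum => j; exact: has_meanZ.
- by apply: has_mean_sum => j; apply: has_mean_sum => l; exact: has_meanZ.
Qed.

Lemma expectation_sqnorm {m n} (xi : 'I_n -> {RV P >-> K}) sigma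
    (c : 'cV[K]_m) (M : 'M[K]_(m, n)) (N : K) :
  white_noise xi sigma ->
  ('E_P[fun w => (norm2 (c + M *m \col_i xi i w) ^+ 2 / N)%R] =
   ((norm2 c ^+ 2 + sigma ^+ 2 * \sum_i \sum_j M i j ^+ 2) / N)%:E)%E.
Proof.
move=> /(has_mean_sqnorm c M)/(has_meanZ N^-1) => -[_].
by under eq_fun do rewrite mulrC; rewrite [in RHS]mulrC.
Qed.
End Moments.

(** * Bias and variance of the sketched estimator *)

Theorem theorem9 (K : realType) (disp : measure_display)
  (W : measurableType disp) (P : probability W K) (n d k : nat)
  (A : 'M[K]_(n, d)) (U : 'M[K]_(n, minn n d)) (s : 'rV[K]_(minn n d))
  (V : 'M[K]_(d, minn n d)) (f : 'cV[K]_n) (xi : 'I_n -> {RV P >-> K})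
  (sigma nu : K) (xstar : 'cV[K]_d) (R : 'M[K]_(d, k))
  (hk : (1 <= k)%N) (hrank : (k <= \rank A)%N)
  (hsvd : is_thin_svd A U s V)
  (hgap : sing s k.+1 < sing s k)
  (hxi : white_noise xi sigma)
  (hxstar : is_min_norm_minimizer (risk P A (response f xi)) xstar)
  (hnu : 0 < nu < 1)
  (hR : orthonormal_cols R)
  (hdist : subspace_dist R (first_cols (rank_le_minn hrank) V)
             <= nu / Num.sqrt (1 + nu ^+ 2)) :
  (excess_risk P A (response f xi) xstar (x_sketch R) <=
   ((1 + nu) * norm2 xstar ^+ 2 * sing s k.+1 ^+ 2 / n%:R
      + sigma ^+ 2 * k%:R / n%:R)%:E)%E.
Proof.
have /andP[nu0 nu1] := hnu.
have n_gt0 : 0 < n%:R :> K.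
  by rewrite ltr0n (leq_trans hk)// (leq_trans hrank)// rank_leq_row.
pose negI := (- 1%:M : 'M[K]_n).
have riskE y : risk P A (response f xi) y =
    ((norm2 (A *m y - f) ^+ 2
      + sigma ^+ 2 * \sum_i \sum_j negI i j ^+ 2) / n%:R)%:E.
  rewrite -(expectation_sqnorm _ _ _ hxi); congr expectation; apply/funext => w.
  by rewrite /response /negI mulNmx mul1mx opprD addrA.
have fit : A *m xstar = A *m mpinv A *m f.
  apply: least_squares_fit => y; have := hxstar.1 y.
  by rewrite !riskE lee_fin ler_pM2r ?invr_gt0// lerD2r.
pose Q := A *m R *m mpinv (A *m R).
have [idQ symQ QAR] := mpinv_proj (A *m R).
have [_ symA PA] := mpinv_proj A.
(* Taking transposes, this says that A A^+ fixes the range of A R. *)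
have QA : Q *m (A *m mpinv A) = Q.
  by rewrite -[LHS]trmxK trmx_mul symA symQ !mulmxA PA -symQ trmxK.
have -> : excess_risk P A (response f xi) xstar (x_sketch R) =
    ((norm2 (Q *m (A *m xstar) - A *m xstar) ^+ 2 + sigma ^+ 2 * \tr Q)
      / n%:R)%:E.
  rewrite -(frobenius_proj idQ symQ) -(expectation_sqnorm _ _ _ hxi).
  congr expectation; apply/funext => w.
  rewrite /x_sketch /response [in RHS]fit [Q *m (_ *m f)]mulmxA QA -fit.
  by rewrite !mulmxA mulmxDr addrAC.
rewrite lee_fin -mulrDl ler_pM2r ?invr_gt0// lerD//; last first.
  by rewrite ler_wpM2l ?sqr_ge0// trace_mpinv_le.
apply: le_trans (sketch_bias_le xstar nu0 hsvd hR hdist) _.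
rewrite !ler_wpM2r ?sqr_ge0// lerD2l expr2 ler_piMr// ltW//.
Qed.
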